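(* For each positive integer $m$ there exists a constant $c(m)$ such that each compact metric space $X$ satisfies the inequality $$UW_{m-1}(X)\le c(m)\,\mathrm{HC}_m(X)^{\frac1m}.$$
   Context: The $m$-dimensional Hausdorff content $\mathrm{HC}_m(X)$ of a metric space $X$ is the infimum of $\sum_i r_i^m$ over all coverings of $X$ by countably many closed metric balls $B(x_i,r_i)$ in $X$. For a non-negative integer $q$, the $q$-dimensional Urysohn width $UW_q(X)$ is the infimum of $W$ such that there exist a $q$-dimensional simplicial complex $K$ and a continuous map $\pi:X\to K$ such that every fiber $\pi^{-1}(s)$, $s\in K$, has diameter $\le W$ in $X$. *)

(* Defs.v *)
From HB Require Import structures.
From mathcomp Require Import all_boot all_order all_algebra finmap.
From mathcomp Require Import all_classical all_reals all_analysis.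

Set Implicit Arguments.
Unset Strict Implicit.
Unset Printing Implicit Defensive.

Import Order.TTheory GRing.Theory Num.Theory.
Import numFieldNormedType.Exports.

Local Open Scope classical_set_scope.
Local Open Scope ring_scope.

(* The library's [closed_ball] is the closure of the open ball, which in a
   general metric space can be smaller than the closed metric ball. *)
Definition cmball (R : realType) (X : metricType R) (x : X) (r : R) : set X :=
  [set y | mdist x y <= r].

(* A countable family may be finite, and is empty when [I] is. *)
Definition hausdorff_content (R : realType) (m : nat) (X : metricType R)
    : \bar R :=
  ereal_inf [set s : \bar R | exists (I : countType) (x : I -> X) (r : I -> R),
    [/\ forall i, 0 <= r i,
        \bigcup_i cmball (x i) (r i) = [set: X]
      & s = \esum_(i in [set: I]) (r i ^+ m)%:E]].

(* The element 0 only matters for the empty set, whose diameter is thus 0. *)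
Definition diameter (R : realType) (X : metricType R) (A : set X) : \bar R :=
  ereal_sup ([set 0%E] `|` [set (mdist x y)%:E | x in A & y in A]).

(* Not every element of [V] has to be a vertex. *)
Record simplicial_complex (V : choiceType) := SimplicialComplex {
  simplex : set {fset V};
  simplex_neq0 : forall s, simplex s -> s != fset0;
  simplex_sub : forall s t : {fset V},
    simplex s -> t != fset0 -> (t `<=` s)%fset -> simplex t
}.

Definition has_dim (V : choiceType) (K : simplicial_complex V) (q : nat) : Prop :=
  (forall s, simplex K s -> (#|` s| <= q.+1)%N) /\
  (exists2 s, simplex K s & #|` s| = q.+1).

(* The closed geometric simplex spanned by [s], in barycentric coordinates. *)
Definition closed_cell (R : realType) (V : choiceType) (s : {fset V})
    : set (V -> R) :=
  [set t | [/\ forall v, 0 <= t v,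
               forall v, v \notin s -> t v = 0
             & \sum_(v <- s) t v = 1]].
Arguments closed_cell R {V} s.

Definition realization (R : realType) (V : choiceType)
    (K : simplicial_complex V) : Type :=
  {t : V -> R | exists2 s, simplex K s & closed_cell R s t}.

(* The weak (coherent) topology: a set is open iff its trace on every closed
   simplex is.  On a closed simplex the Euclidean topology is the one induced by
   pointwise convergence, since only finitely many coordinates are nonzero. *)
Definition realization_open (R : realType) (V : choiceType)
    (K : simplicial_complex V) (U : set (realization R K)) : Prop :=
  forall s, simplex K s -> exists2 O : set {ptws V -> R}, open O &
    forall p : realization R K, closed_cell R s (sval p) -> (U p <-> O (sval p)).

Section realization_topology.
Variables (R : realType) (V : choiceType) (K : simplicial_complex V).

HB.instance Definition _ := gen_eqMixin (realization R K).
HB.instance Definition _ := gen_choiceMixin (realization R K).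

Fact realization_openT : realization_open [set: realization R K].
Proof. by move=> s Ks; exists setT => //; exact: openT. Qed.

Fact realization_openI (A B : set (realization R K)) :
  realization_open A -> realization_open B -> realization_open (A `&` B).
Proof.
move=> oA oB s Ks; have [OA ? AE] := oA s Ks; have [OB ? BE] := oB s Ks.
exists (OA `&` OB); first exact: openI.
by move=> p sp; split=> -[pA pB]; split; [apply/AE|apply/BE|apply/AE|apply/BE].
Qed.

Fact realization_open_bigU (I : Type) (f : I -> set (realization R K)) :
  (forall i, realization_open (f i)) -> realization_open (\bigcup_i f i).
Proof.
move=> of_ s Ks.
pose P i (O : set {ptws V -> R}) := open O /\
  forall p : realization R K, closed_cell R s (sval p) -> (f i p <-> O (sval p)).
have /choice [g gP] : forall i, exists O, P i O.
  by move=> i; have [W ? ?] := of_ i s Ks; exists W.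
exists (\bigcup_i g i); first by apply: bigcup_open => i _; exact: (gP i).1.
move=> p sp; split=> -[i _ ip]; exists i => //; first exact/(gP i).2.
by apply/(gP i).2.
Qed.

HB.instance Definition _ :=
  isOpenTopological.Build (realization R K)
    realization_openT realization_openI realization_open_bigU.

End realization_topology.

Definition urysohn_width (R : realType) (q : nat) (X : metricType R) : \bar R :=
  ereal_inf [set W%:E | W in [set W : R |
    exists (V : choiceType) (K : simplicial_complex V)
           (f : X -> realization R K),
      [/\ has_dim K q, continuous f
        & forall p, (diameter (f @^-1` [set p]) <= W%:E)%E]]].

(* Main.v *)
From HB Require Import structures.
Require Import Defs.
From mathcomp Require Import all_boot all_order all_algebra finmap.
From mathcomp Require Import all_classical all_reals all_analysis.
From mathcomp Require Import measurable_realfun lra.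
Set Implicit Arguments.
Unset Strict Implicit.
Unset Printing Implicit Defensive.
Import Order.TTheory GRing.Theory Num.Theory.
Import numFieldNormedType.Exports.
Local Open Scope classical_set_scope.
Local Open Scope ring_scope.

(** Why the theorem holds, with [c(m) = 6 m + 2].  Slightly enlarge the balls of
    an almost optimal covering so that finitely many open balls [B(x_i, r_i)]
    cover [X] and [\sum_i r_i ^ m < a ^ m], where [a] is as close as desired to
    [HC_m(X) ^ (1/m)].  It suffices to split this finite family into [m] levels
    such that, inside each level, every cluster (class of balls connected by a
    chain of touching balls) has diameter at most [(6 m + 2) a].  The unions of
    clusters then form an open cover of multiplicity at most [m], since two
    clusters of one level are disjoint, and a partition of unity subordinate to
    it maps [X] to an (m-1)-dimensional skeleton with small fibers
    ([urysohn_width_le_partition]).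

    The levels come from a discrete form of the minimal separating hypersurface
    argument ([exists_separating_subfamily]).  Start with [J_m] the whole
    family.  Given [J_(k+1)], let [J_k] be a subfamily of least weight
    [\sum_(i in J_k) r_i ^ k] among those whose removal leaves only clusters of
    diameter [O(k a)]: a finite family of balls of weight [r ^ k] plays the role
    of a k-dimensional hypersurface cutting a (k+1)-dimensional object.
    Replacing the part of [J_k] inside a ball [B(p, t)] by the members of
    [J_(k+1)] that meet the sphere of radius [t] still separates, so by
    minimality the part of [J_k] inside weighs no more than these members.
    Averaging over [t] (a coarea inequality, [exists_light_level]) bounds their
    weight by the local weight of [J_(k+1)], one dimension higher.  Thus a local
    weight bound [< a ^ k] descends from [k = m], where it is the hypothesis on
    the cover, to [k = 0], where it says that fewer than one ball remains.  So
    [J_0] is empty, and the differences [J_(k+1) \ J_k] are the [m] levels. *)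

(** * A coarea inequality *)

(** The integral over [[u, v]] of the weight of the intervals containing [t] is
    at most the sum of weight times length, so the weight cannot be [>= c] for
    all [t]. *)
Lemma exists_light_level (R : realType) (T : finType) (P : pred T) (w l h : T -> R)
    (u v c : R) :
  (forall i, 0 <= w i) -> (forall i, l i <= h i) -> u <= v ->
  \sum_(i | P i) w i * (h i - l i) < c * (v - u) ->
  exists2 t, u <= t <= v & \sum_(i | P i && (l i <= t <= h i)) w i < c.
Proof.
move=> w0 lh uv small; apply: contrapT => no.
have {no} thick t : u <= t <= v -> c <= \sum_(i | P i && (l i <= t <= h i)) w i.
  by move=> tuv; rewrite leNgt; apply/negP => tc; apply: no; exists t.
have c0 : 0 <= c.
  have : 0 < c * (v - u).
    by apply: le_lt_trans small; apply: sumr_ge0 => i _; rewrite mulr_ge0 ?subr_ge0.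
  by move=> cuv; rewrite leNgt; apply/negP => c0; nra.
pose mu := @lebesgue_measure R.
pose f i (t : measurableTypeR R) : \bar R := ((w i)%:E * (\1_`[l i, h i] t)%:E)%E.
have mf i : measurable_fun (`[u, v] : set (measurableTypeR R)) (f i).
  apply: measurable_funeM; apply/measurable_EFinP.
  by apply: measurable_indic.
have f0 i t : (0 <= f i t)%E by rewrite mule_ge0 // lee_fin.
have : ((c * (v - u))%:E <= (\sum_(i | P i) w i * (h i - l i))%:E)%E.
  apply: (@le_trans _ _ (\int[mu]_(t in `[u, v]) c%:E)%E).
    rewrite integral_cst // /= /mu lebesgue_measure_itv /= lte_fin.
    move: uv; rewrite le_eqVlt => /orP[/eqP ->|->]; last by rewrite EFinM EFinB.
    by rewrite subrr mulr0 ltxx mule0.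
  apply: (@le_trans _ _ (\int[mu]_(t in `[u, v]) \sum_(i <- enum P) f i t)%E).
    apply: ge0_le_integral => //.
      by apply: emeasurable_sum.
    move=> t; rewrite /= in_itv /= => tuv; rewrite big_enum /=.
    apply: le_trans (_ : (\sum_(i | P i && (l i <= t <= h i)) w i)%:E <= _)%E.
      by rewrite lee_fin thick.
    rewrite big_mkcondr /= -sumEFin; apply: lee_sum => i _.
    rewrite /f indicE mem_setE in_itv /=.
    by case: ifP => _; rewrite -EFinM lee_fin ?mulr1 ?mulr0.
  rewrite ge0_integral_sum // big_enum /= -sumEFin; apply: lee_sum => i _.
  rewrite /f ge0_integralZl //=; first last.
  - by rewrite lee_fin.
  - by apply/measurable_EFinP; apply: measurable_indic.
  rewrite integral_indic // EFinM; apply: lee_wpmul2l; first by rewrite lee_fin.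
  apply: (@le_trans _ _ (mu [set` `[l i, h i]])%E).
    by apply: le_measure; rewrite ?inE //; apply: measurableI.
  rewrite /mu lebesgue_measure_itv /= lte_fin EFinB.
  by case: ifP => // _; rewrite -EFinB lee_fin subr_ge0.
by rewrite lee_fin leNgt small.
Qed.

(** * Cutting a family of balls into levels *)

(** Shows that a chain starting on one side of a sphere, or in one level, is
    also a chain of a smaller family of balls. *)
Lemma connect_invariant (T : finType) (e e' : rel T) (Q : pred T) (i j : T) :
  (forall a b, e a b -> Q a -> Q b && e' a b) ->
  Q i -> connect e i j -> Q j && connect e' i j.
Proof.
move=> ee' Qi /connectP[p ep ->] {j}.
elim: p i Qi ep => [|k p IH] i Qi /=; first by rewrite Qi connect0.
case/andP=> eik ep; have /andP[Qk e'ik] := ee' _ _ eik Qi.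
have /andP[-> ckp] := IH _ Qk ep.
by rewrite (connect_trans (connect1 e'ik) ckp).
Qed.

Section Levels.
Variables (R : realType) (X : metricType R) (I : finType).
Variables (x : I -> X) (r : I -> R).
Hypothesis r_ge0 : forall i, 0 <= r i.

(** Implied by the balls having a common point, and stated with centers and
    radii alone.  It is still strong enough that no two touching balls lie on
    different sides of a sphere that both avoid. *)
Definition touch (i j : I) := mdist (x i) (x j) <= r i + r j.

Definition link (S : {set I}) : rel I :=
  fun i j => [&& i \in S, j \in S & touch i j].

(** A bound on centers only; the radii enter at the very end. *)
Definition clusters_le (S : {set I}) (D : R) :=
  [forall i, forall j, connect (link S) i j ==> (mdist (x i) (x j) <= D)].

Lemma clusters_leP S D :
  reflect (forall i j, connect (link S) i j -> mdist (x i) (x j) <= D)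
          (clusters_le S D).
Proof.
apply: (iffP forallP) => [H i j cij|H i].
  by have /forallP/(_ j)/implyP/(_ cij) := H i.
by apply/forallP => j; apply/implyP/H.
Qed.

(** Along a chain of balls that all avoid the sphere of radius [t] around [p],
    either every ball is inside, and two centers are at distance at most
    [2 t], or every ball is outside, and the chain already existed in [S]. *)
Lemma cut_clusters_le (S S' : {set I}) (p : X) (t D : R) :
  t + t <= D -> clusters_le S D ->
  (forall i, i \in S' -> `|mdist p (x i) - t| > r i) ->
  (forall i, i \in S' -> t < mdist p (x i) -> i \in S) ->
  clusters_le S' D.
Proof.
move=> tD /clusters_leP SD off out; apply/clusters_leP => i j cij.
have side k : k \in S' -> (mdist p (x k) + r k < t) || (t + r k < mdist p (x k)).
  by move=> /off; rewrite ltr_normr => /orP[] H; apply/orP; [right|left]; lra.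
have [in_i|out_i] := leP (mdist p (x i)) t; last first.
  have step a b : link S' a b -> t < mdist p (x a) ->
      (t < mdist p (x b)) && link S a b.
    case/and3P=> Sa Sb tab ta; move: (tab); rewrite /touch => tab'.
    have tri := metric_triangle p (x b) (x a).
    rewrite (metric_sym (x b)) in tri.
    have tb : t < mdist p (x b).
      by have := side _ Sa; have := side _ Sb; have := r_ge0 a; have := r_ge0 b;
         move=> ? ? /orP[] ? /orP[] ?; lra.
    by rewrite tb /link !out.
  by have /andP[_ /SD] := connect_invariant step out_i cij.
have step a b : link S' a b -> mdist p (x a) <= t ->
    (mdist p (x b) <= t) && link S' a b.
  case/and3P=> Sa Sb tab ta; rewrite /link Sa Sb tab !andbT.
  have tri := metric_triangle p (x a) (x b).
  move: tab; rewrite /touch => tab.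
  by have := side _ Sa; have := side _ Sb; have := r_ge0 a; have := r_ge0 b;
     move=> ? ? /orP[] ? /orP[] ?; lra.
have /andP[in_j _] := connect_invariant step in_i cij.
by have := metric_triangle (x i) p (x j); rewrite (metric_sym (x i) p); lra.
Qed.

(** The local smallness that is passed from dimension [k + 1] to [k].  The scale
    [3 k a] shrinks by [3 a] at each step, which leaves room for a sphere of
    radius in [[3 k a, 3 k a + 2 a]] thickened by balls of radius less than
    [a]. *)
Definition thin (a : R) (k : nat) (J : {set I}) :=
  forall p : X,
    \sum_(i in J | mdist p (x i) <= (3 * k)%:R * a) r i ^+ k < a ^+ k.

Variable a : R.
Hypothesis a_gt0 : 0 < a.
Hypothesis r_lt : forall i, r i < a.

(** In dimension [0] each ball weighs [1] and the bound is [1]. *)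
Lemma thin0_eq0 (J : {set I}) : thin a 0 J -> J = finset.set0.
Proof.
move=> J0; apply/eqP; rewrite -finset.subset0; apply/fintype.subsetP => i iJ.
have := J0 (x i); rewrite (bigD1 i) /=; last by rewrite iJ mdistxx muln0 mul0r lexx.
by rewrite expr0 ltNge lerDl sumr_ge0.
Qed.

(** The subfamily of least k-dimensional weight that cuts [J] into small
    clusters inherits thinness: near [p] it can be traded for the balls of [J]
    that meet a well-chosen sphere around [p]. *)
Lemma exists_separating_subfamily (k : nat) (J : {set I}) : thin a k.+1 J ->
  exists J' : {set I}, [/\ J' \subset J, thin a k J' &
    clusters_le (J :\: J') ((6 * k.+1)%:R * a)].
Proof.
move=> thinJ; set D := (6 * k.+1)%:R * a.
have a_ge0 := ltW a_gt0.
pose W (S : {set I}) := \sum_(i in S) r i ^+ k.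
pose adm (S : {set I}) := (S \subset J) && clusters_le (J :\: S) D.
have admJ : adm J.
  rewrite /adm subxx finset.setDv; apply/clusters_leP => i j.
  case/connectP=> [[|l q]] /=; last by rewrite /link inE.
  by move=> _ ->; rewrite mdistxx mulr_ge0.
have [J' /andP[J'J J'D] J'min] := arg_minP W admJ.
exists J'; split => // p.
pose d i := mdist p (x i).
(* Ball [i] can meet the sphere of radius [t] only for [t] in an interval of
   length [2 r_i], so the total is twice the (k+1)-dimensional weight. *)
have [||||t /andP[tl tu] tW] := @exists_light_level R I
  (fun i => (i \in J) && (d i <= (3 * k.+1)%:R * a)) (fun i => r i ^+ k)
  (fun i => d i - r i) (fun i => d i + r i)
  ((3 * k)%:R * a) ((3 * k)%:R * a + 2 * a) (a ^+ k).
- by move=> i; rewrite exprn_ge0.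
- by move=> i; have := r_ge0 i; lra.
- by lra.
- have -> : a ^+ k * ((3 * k)%:R * a + 2 * a - (3 * k)%:R * a) = 2 * a ^+ k.+1.
    by rewrite exprSr; lra.
  apply: le_lt_trans (_ : 2 * _ < _); last by rewrite ltr_pM2l //; exact: thinJ p.
  rewrite mulr_sumr; apply: ler_sum => i _.
  by rewrite exprSr; lra.
pose A := [set i in J | d i - r i <= t <= d i + r i].
(* The competitor: [J'] outside the sphere, everything in [J] on the sphere. *)
pose J2 := A :|: [set i in J' | t < d i].
have kE : (3 * k.+1)%:R * a = (3 * k)%:R * a + 3 * a.
  by rewrite mulnS natrD mulrDl addrC.
have admJ2 : adm J2.
  apply/andP; split.
    apply/fintype.subsetP => i; rewrite !inE => /orP[/andP[]//|/andP[iJ' _]].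
    exact: (fintype.subsetP J'J).
  apply: (@cut_clusters_le (J :\: J') _ p t) => //.
  - have -> : D = (3 * k.+1)%:R * a + (3 * k.+1)%:R * a.
      by rewrite /D -mulrDl -natrD -mulnDl.
    by lra.
  - move=> i; rewrite !inE => /andP[+ iJ]; rewrite iJ /= negb_or => /andP[+ _].
    rewrite negb_and -!ltNge ltr_normr => /orP[] ?; apply/orP; rewrite -/(d i);
    [left|right]; lra.
  - move=> i; rewrite !inE -/(d i) => /andP[+ ->] ti; rewrite ti !andbT.
    by rewrite negb_or => /andP[_ ->].
have WA : W A < a ^+ k.
  apply: le_lt_trans tW; rewrite le_eqVlt; apply/orP; left; apply/eqP.
  apply: eq_bigl => i; rewrite !inE; case: (i \in J) => //=.
  case: (boolP (d i - r i <= t <= d i + r i)) => [/andP[? ?]|]; last by rewrite andbF.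
  by rewrite andbT; apply/esym; have := r_lt i; lra.
have : W J' <= W A + \sum_(i in J' | t < d i) r i ^+ k.
  apply: le_trans (J'min _ admJ2) _.
  rewrite /W /J2 [X in _ <= X + _]big_mkcond [X in X <= _]big_mkcond /=.
  rewrite [X in _ <= _ + X]big_mkcond /= -big_split /=; apply: ler_sum => i _.
  have if_or (b1 b2 : bool) (y : R) : 0 <= y ->
    (if b1 || b2 then y else 0) <= (if b1 then y else 0) + (if b2 then y else 0).
    by case: b1 b2 => [] [] /=; lra.
  by rewrite !inE; apply: if_or; exact: exprn_ge0.
rewrite /W (bigID (fun i => t < d i)) /= addrC lerD2r => inner.
apply: le_lt_trans WA; apply: le_trans inner.
rewrite big_mkcondr [X in _ <= X]big_mkcondr /=; apply: ler_sum => i _.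
case: ifP => di; last by case: ifP => // _; exact: exprn_ge0.
by rewrite -leNgt (le_trans di tl).
Qed.

(** The level function packs the decreasing chain of subfamilies: the level of
    [i] is the [k] for which [i] is in the (k+1)-st but not in the k-th. *)
Definition level_link (lev : I -> nat) (J : {set I}) : rel I :=
  fun i j => [&& i \in J, j \in J, lev i == lev j & touch i j].

Lemma exists_levels (k : nat) (J : {set I}) : thin a k J ->
  exists lev : I -> nat, (forall i, i \in J -> (lev i < k)%N) /\
    forall i j, connect (level_link lev J) i j -> mdist (x i) (x j) <= (6 * k)%:R * a.
Proof.
elim: k J => [|k IH] J.
  move=> /thin0_eq0 ->; exists (fun=> 0%N); split=> [i|i j]; first by rewrite inE.
  case/connectP=> [[|l q]] /=; last by rewrite /level_link inE.
  by move=> _ ->; rewrite mdistxx muln0 mul0r.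
move=> /exists_separating_subfamily[J' [J'J /IH[lev' [lev'k lev'D]] /clusters_leP cD]].
exists (fun i => if i \in J' then lev' i else k); split=> [i _|i j].
  by case: ifP => // /lev'k/ltnW.
have [iJ'|iJ'] := boolP (i \in J') => cij.
  have /andP[_ /lev'D] : (j \in J') && connect (level_link lev' J') i j.
    apply: (connect_invariant (Q := fun b => b \in J') _ iJ' cij).
    move=> b c /and4P[_ _ + tbc] bJ'; rewrite bJ'.
    have lb := lev'k _ bJ'.
    case: ifP => [cJ' lbc|_ /eqP lbk]; first by rewrite /level_link bJ' cJ' lbc.
    by rewrite lbk ltnn in lb.
  by move/le_trans; apply; rewrite ler_pM2r // ler_nat leq_mul2l leqnSn orbT.
have /andP[_ /cD//] : (j \notin J') && connect (link (J :\: J')) i j.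
apply: (connect_invariant (Q := fun b => b \notin J') _ iJ' cij).
move=> b c /and4P[bJ cJ + tbc] bJ'.
rewrite (negbTE bJ') /link !inE bJ' bJ cJ tbc /=.
by case: ifP => // /lev'k + /eqP lc; rewrite -lc ltnn.
Qed.

End Levels.

(** * Maps to the realization of a finite complex *)

Section Skeleton.
Variables (V : choiceType) (n : nat).

Fact skeleton_neq0 (s : {fset V}) : s != fset0 /\ (#|` s| <= n)%N -> s != fset0.
Proof. by case. Qed.

Fact skeleton_sub (s t : {fset V}) : s != fset0 /\ (#|` s| <= n)%N ->
  t != fset0 -> (t `<=` s)%fset -> t != fset0 /\ (#|` t| <= n)%N.
Proof. by move=> [_ sn] t0 ts; split=> //; apply: leq_trans (fsubset_leq_card ts) sn. Qed.

Definition skeleton := SimplicialComplex skeleton_neq0 skeleton_sub.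

End Skeleton.

Lemma sum_fset_support (R : realType) (V : finType) (s : {fset V}) (t : V -> R) :
  (forall v, v \notin s -> t v = 0) -> \sum_(v <- s) t v = \sum_v t v.
Proof.
move=> t0; rewrite big_uniq ?fset_uniq //= [RHS](bigID [in s]) /=.
by rewrite [X in _ = _ + X]big1 ?addr0.
Qed.

(** On a finite vertex set there are finitely many closed cells.  Points near [y]
    avoid the cells that miss [f y], because a coordinate of [f y] outside such
    a cell stays nonzero; on each remaining cell the topology is the pointwise
    one. *)
Lemma continuous_realization (R : realType) (X : topologicalType) (V : finType)
    (K : simplicial_complex V) (f : X -> realization R K) :
  (forall v, continuous (fun y => sval (f y) v)) -> continuous f.
Proof.
move=> cf; apply/continuousP => U oU; rewrite openE => y Uy.
have cy : (sval \o f) z @[z --> y] --> (sval (f y) : {ptws V -> R}).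
  apply/cvg_sup => v A [_ [[C oC <-] Cy] CA].
  by apply: filterS CA _; apply: cf; apply: open_nbhs_nbhs.
suff near_cell : \forall z \near y, forall s : {fset V},
    simplex K s -> closed_cell R s (sval (f z)) -> U (f z).
  rewrite /interior /=; apply: filterS near_cell => z Uz.
  by have [s Ks sz] := svalP (f z); exact: Uz Ks sz.
apply: (filter_forall (f := fun (s : {fset V}) z =>
  simplex K s -> closed_cell R s (sval (f z)) -> U (f z))) => s.
have [Ks|nKs] := pselect (simplex K s); last by apply: nearW.
have [supp|] := pselect (forall v, v \notin s -> sval (f y) v = 0).
  have [B oB UB] := oU s Ks.
  have [s' _ [y_ge0 supp' sum1]] := svalP (f y).
  have sy : closed_cell R s (sval (f y)).
    by split=> //; rewrite sum_fset_support // -(sum_fset_support supp').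
  have /open_nbhs_nbhs : open_nbhs (sval (f y) : {ptws V -> R}) B.
    by split=> //; apply/(UB (f y) sy).
  move=> /cy yB.
  have {yB} : nbhs y ((sval \o f) @^-1` B) := yB.
  by apply: filterS => z Bz _ sz; apply/(UB _ sz).
move=> /existsNP[v /not_implyP[vs /eqP yv]].
have nz : nbhs (sval (f y) v) [set a : R | a != 0].
  by apply: open_nbhs_nbhs; split=> //; exact: open_neq.
have {nz} : nbhs y ((fun z => sval (f z) v) @^-1` [set a | a != 0]) := cf v y _ nz.
by apply: filterS => z /= zv _ [_ /(_ _ vs) zv0 _]; rewrite zv0 eqxx in zv.
Qed.

Lemma continuous_sum (R : realType) (X : topologicalType) (I : Type) (s : seq I)
    (P : pred I) (g : I -> X -> R) :
  (forall i, continuous (g i)) -> continuous (fun y => \sum_(i <- s | P i) g i y).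
Proof.
move=> cg; elim: s => [|i s IH].
  by under eq_fun do rewrite big_nil; move=> y; exact: cvg_cst.
under eq_fun do rewrite big_cons.
by case: (P i) => // y; apply: cvgD; [exact: cg|exact: IH].
Qed.

(** Normalizing [phi] gives barycentric coordinates with at most [m] nonzero
    ones, and a point of the fiber determines a vertex [v] with [phi v] positive
    on the whole fiber.  The vertices in ['I_m] provide a simplex of dimension
    exactly [m - 1] even when [V] is small. *)
Lemma urysohn_width_le_partition (R : realType) (X : metricType R) (V : finType)
    (m : nat) (W : R) (phi : V -> X -> R) :
  (0 < m)%N -> 0 <= W ->
  (forall v, continuous (phi v)) -> (forall v y, 0 <= phi v y) ->
  (forall y, exists v, 0 < phi v y) ->
  (forall y, (#|[pred v | (0 < phi v y)%R]| <= m)%N) ->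
  (forall v y z, 0 < phi v y -> 0 < phi v z -> mdist y z <= W) ->
  (urysohn_width m.-1 X <= W%:E)%E.
Proof.
move=> m0 W0 cphi phi0 phi_cover mult phiW.
pose V' : finType := (V + 'I_m)%type.
pose S y := \sum_v phi v y.
have S0 y : 0 < S y.
  have [v vy] := phi_cover y.
  by rewrite /S (bigD1 v) //= ltr_pwDl // sumr_ge0.
pose t y (v : V') : R := if v is inl v then phi v y / S y else 0.
pose K := @skeleton V' m.
have tK y : exists2 s, simplex K s & closed_cell R s (t y).
  pose P : pred V' := [pred v | t y v != 0].
  have tP v : (v \in [fset v in enum P]%fset) = (t y v != 0).
    by rewrite inE /= mem_enum.
  have tS (v : V) : (t y (inl v) != 0) = (0 < phi v y).
    by rewrite /t mulf_eq0 invr_eq0 (gt_eqF (S0 y)) orbF lt_neqAle phi0 andbT eq_sym.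
  exists [fset v in enum P]%fset; first split.
  - have [v vy] := phi_cover y; apply/fset0Pn; exists (inl v).
    by rewrite tP tS.
  - rewrite card_fseq; apply: leq_trans (size_undup _) _; rewrite -cardE.
    apply: leq_trans (mult y).
    rewrite -(fintype.card_image (@inl_inj V 'I_m)).
    apply: subset_leq_card; apply/fintype.subsetP => -[v|j] vP.
      by apply/fintype.imageP; exists v => //; rewrite inE -tS.
    by move: vP; rewrite inE /= eqxx.
  split.
  - by move=> [v|j] //=; rewrite divr_ge0 // ltW.
  - by move=> v; rewrite tP negbK => /eqP.
  - rewrite sum_fset_support; last by move=> v; rewrite tP negbK => /eqP.
    rewrite big_sumType /= [X in _ + X]big1 // addr0 -mulr_suml.
    by rewrite -/(S y) divff ?gt_eqF.
pose f y : realization R K := exist _ (t y) (tK y).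
apply: ereal_inf_lbound; exists W => //; exists V', K, f; split.
- split=> [s [_]|]; first by rewrite prednK.
  pose Q : pred V' := [pred v | if v is inr _ then true else false].
  have cQ : #|` [fset v in enum Q]%fset| = m.
    rewrite card_fseq undup_id ?enum_uniq // -cardE.
    rewrite -[RHS]card_ord -(fintype.card_image (@inr_inj V 'I_m)).
    apply: eq_card => -[v|j]; rewrite !inE /=.
      by apply/esym/negbTE/negP => /fintype.imageP[].
    by apply/esym; apply/fintype.imageP; exists j.
  exists [fset v in enum Q]%fset; last by rewrite cQ prednK.
  by split; rewrite ?cQ // -cardfs_gt0 cQ.
- apply: continuous_realization => -[v|j] y /=; last exact: cvg_cst.
  apply: cvgM; first exact: cphi.
  apply: cvgV; first by rewrite gt_eqF.
  exact: continuous_sum.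
- move=> p; apply: ge_ereal_sup => /= u [->|[y fy [z fz <-]]]; rewrite lee_fin //.
  have tyz : t y = t z by rewrite -[t y]/(sval (f y)) -[t z]/(sval (f z)) fy fz.
  have [v vy] := phi_cover y; apply: (phiW v) => //.
  have : 0 < t z (inl v) by rewrite -tyz /= divr_gt0.
  by rewrite /= pmulr_lgt0 // invr_gt0.
Qed.

(** * Width of a space covered by small balls *)

Lemma continuous_mdist (R : realType) (X : metricType R) (p : X) :
  continuous (fun y : X => mdist p y : R).
Proof.
move=> y; apply/cvgrPdist_lt => e e0.
apply: filterS (nbhsx_ballx y e e0) => z; rewrite ballEmdist /= => yz.
apply: le_lt_trans yz; rewrite ler_norml.
have := metric_triangle p y z; have := metric_triangle p z y.
by rewrite (metric_sym z y); lra.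
Qed.

(** Vertices are the clusters, represented by their roots, and the function of
    a cluster is the sum of the depths of [y] in its balls.  Two clusters seen
    from one point [y] contain touching balls, hence lie on different levels. *)
Lemma urysohn_width_le_balls (R : realType) (X : metricType R) (I : finType)
    (x : I -> X) (r : I -> R) (m : nat) (a : R) :
  (0 < m)%N -> 0 < a -> (forall i, 0 <= r i) ->
  (forall y, exists i, mdist (x i) y < r i) ->
  \sum_i r i ^+ m < a ^+ m ->
  (urysohn_width m.-1 X <= ((6 * m + 2)%:R * a)%:E)%E.
Proof.
move=> m0 a0 r0 cover small.
have ra i : r i < a.
  rewrite -(ltr_pXn2r m0) ?nnegrE // ?ltW //; apply: le_lt_trans small.
  by rewrite (bigD1 i) //= lerDl sumr_ge0 // => j _; exact: exprn_ge0.
have thinT : thin x r a m finset.setT.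
  move=> p; apply: le_lt_trans small; rewrite big_mkcond /=; apply: ler_sum => i _.
  by case: ifP => _ //; exact: exprn_ge0.
have [lev [levm levD]] := exists_levels r0 a0 ra thinT.
set e := level_link x r lev finset.setT in levD.
have eE i j : e i j = (lev i == lev j) && touch x r i j by rewrite /e /level_link !inE.
have e_sym : connect_sym e.
  apply: sym_connect_sym => i j.
  by rewrite !eE eq_sym /touch (metric_sym (x i)) (addrC (r i)).
have lev_e i j : connect e i j -> lev j = lev i.
  have step b c : e b c -> lev b == lev i -> (lev c == lev i) && e b c.
    by move=> ebc; rewrite ebc andbT; move: ebc; rewrite eE => /andP[/eqP ->].
  move=> cij; apply/eqP.
  by have /andP[] := connect_invariant (Q := fun k => lev k == lev i) step (eqxx _) cij.
pose bump i y := Num.max (r i - mdist (x i) y) 0.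
pose phi v y := \sum_(i | fingraph.root e i == v) bump i y.
have bump0 i y : 0 <= bump i y by rewrite /bump le_max lexx orbT.
have phiP v y : 0 < phi v y ->
    exists2 i, fingraph.root e i = v & mdist (x i) y < r i.
  rewrite lt_neqAle eq_sym psumr_neq0 // => /andP[/hasP[i _ /andP[/eqP iv iy]] _].
  by exists i; move: iy; rewrite // /bump lt_max ltxx orbF subr_gt0.
have touching i j y : mdist (x i) y < r i -> mdist (x j) y < r j -> touch x r i j.
  rewrite /touch => iy jy; apply: le_trans (metric_triangle _ y _) _.
  by rewrite (metric_sym y); lra.
apply: (@urysohn_width_le_partition _ _ _ _ _ phi) => //.
- by rewrite mulr_ge0 // ltW.
- move=> v; apply: continuous_sum => i y.
  apply: (@continuous_max _ _ (fun z => r i - mdist (x i) z) (cst 0)); last exact: cvg_cst.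
  by apply: cvgB; [exact: cvg_cst|exact: continuous_mdist].
- by move=> v y; apply: sumr_ge0.
- move=> y; have [i iy] := cover y; exists (fingraph.root e i).
  rewrite /phi (bigD1 i) //= ltr_pwDl ?sumr_ge0 //.
  by rewrite /bump lt_max subr_gt0 iy.
- move=> y; pose l i : 'I_m := Ordinal (levm i (finset.in_setT i)).
  rewrite -(@fintype.card_in_image _ _ l).
    by rewrite -[leqRHS]card_ord max_card.
  move=> u v; rewrite !inE => /phiP[i <- iy] /phiP[j <- jy] /(congr1 val) /= luv.
  apply/eqP; rewrite (root_connect e_sym) connect1 // eE (touching _ _ y) // andbT.
  by rewrite -(lev_e _ _ (connect_root e i)) luv (lev_e _ _ (connect_root e j)).
- move=> v y z /phiP[i iv iy] /phiP[j jv jz].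
  have /levD dij : connect e i j by rewrite -(root_connect e_sym) iv jv.
  have := metric_triangle y (x i) z; have := metric_triangle (x i) (x j) z.
  rewrite (metric_sym y (x i)) natrD mulrDl; have := ra i; have := ra j.
  by move: iy jz dij; lra.
Qed.

(** * From the Hausdorff content to a finite open cover *)

(** A topological space may be empty, whereas the open cover characterization of
    compactness is stated for pointed ones. *)
Lemma compact_cover_compact (X : topologicalType) :
  compact [set: X] -> cover_compact [set: X].
Proof.
move=> cX; have [p|no] := pselect (inhabited X); last first.
  by move=> J D f _ _; exists fset0 => // y; case: no; constructor.
case: p => p.
pose P : ptopologicalType := HB.pack X (isPointed.Build X p).
have /(congr1 (fun F => F setT)) E := @compact_cover P.
have {cX} : @compact P setT := cX.
by rewrite E.
Qed.

Lemma sum_half_pow_le1 (R : realFieldType) (s : seq nat) :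
  uniq s -> \sum_(n <- s) (2^-1 : R) ^+ n.+1 <= 1.
Proof.
move=> us; pose N := (\max_(n <- s) n).+1.
have geo k : \sum_(0 <= n < k) (2^-1 : R) ^+ n.+1 = 1 - 2^-1 ^+ k.
  elim: k => [|k IH]; first by rewrite big_geq // expr0 subrr.
  by rewrite big_nat_recr //= IH exprS; lra.
have sN : perm_eq s [seq n <- index_iota 0 N | n \in s].
  apply: uniq_perm; rewrite ?filter_uniq ?iota_uniq // => n.
  rewrite mem_filter mem_index_iota /=; case: (boolP (n \in s)) => //= ns.
  by rewrite ltnS; apply/esym; apply: (@leq_bigmax_seq _ s xpredT id n).
rewrite (perm_big _ sN) big_filter.
apply: (@le_trans _ _ (\sum_(0 <= n < N) (2^-1 : R) ^+ n.+1)).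
  rewrite big_mkcond; apply: ler_sum => n _.
  by case: ifP => // _; rewrite exprn_ge0 // invr_ge0.
by rewrite geo gerBl exprn_ge0 // invr_ge0.
Qed.

(** Radii can be zero, so a common dilation would not make the balls open
    neighborhoods; instead [r_i ^ m] is increased by the i-th term of a series of
    sum [e]. *)
Lemma exists_open_radii (R : realType) (m : nat) (I : countType) (r : I -> R) (e : R) :
  (0 < m)%N -> (forall i, 0 <= r i) -> 0 < e ->
  exists r' : I -> R, (forall i, r i < r' i) /\
    forall F : {fset I}, \sum_(i <- F) r' i ^+ m <= \sum_(i <- F) r i ^+ m + e.
Proof.
move=> m0 r0 e0.
pose d (i : I) : R := e * 2^-1 ^+ (choice.pickle i).+1.
have d0 i : 0 < d i by rewrite mulr_gt0 // exprn_gt0.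
pose s i := r i ^+ m + d i.
have s0 i : 0 <= s i by rewrite addr_ge0 ?exprn_ge0 // ltW.
have sE i : (s i `^ m%:R^-1) ^+ m = s i.
  by rewrite -powR_mulrn ?powR_ge0 // -powRrM mulVf ?powRr1 // pnatr_eq0 -lt0n.
exists (fun i => s i `^ m%:R^-1); split=> [i|F].
  by rewrite -(ltr_pXn2r m0) ?nnegrE ?powR_ge0 // sE ltrDl.
rewrite (eq_bigr s) => [|i _]; last exact: sE.
rewrite big_split /= lerD2l -mulr_sumr -[leRHS]mulr1 ler_pM2l //.
rewrite -(big_map choice.pickle xpredT (fun n => 2^-1 ^+ n.+1)).
by apply: sum_half_pow_le1; rewrite map_inj_uniq ?fset_uniq.
Qed.

Lemma urysohn_width_le_of_content_lt (R : realType) (X : metricType R) (m : nat) (a : R) :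
  (0 < m)%N -> compact [set: X] -> 0 < a ->
  (hausdorff_content m X < (a ^+ m)%:E)%E ->
  (urysohn_width m.-1 X <= ((6 * m + 2)%:R * a)%:E)%E.
Proof.
move=> m0 cX a0 /ereal_inf_lt[_ [I [x [r [r0 cover ->]]]] small].
have content_ge0 : (0 <= \esum_(i in [set: I]) (r i ^+ m)%:E)%E.
  by apply: esum_ge0 => i _; rewrite lee_fin exprn_ge0.
have fin : \esum_(i in [set: I]) (r i ^+ m)%:E \is a fin_num.
  by rewrite ge0_fin_numE // (lt_trans small) // ltry.
set sigma := fine (\esum_(i in [set: I]) (r i ^+ m)%:E).
have sE : \esum_(i in [set: I]) (r i ^+ m)%:E = sigma%:E by rewrite fineK.
rewrite sE lte_fin in small.
have e0 : 0 < (a ^+ m - sigma) / 2 by rewrite divr_gt0 // subr_gt0.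
have [r' [rr' sumr']] := exists_open_radii m0 r0 e0.
have [||F _ FX] := @compact_cover_compact _ cX I setT (fun i => ball (x i) (r' i)).
- move=> i _; rewrite openE => y; rewrite ballEmdist /= => iy.
  have d0 : 0 < r' i - mdist (x i) y by rewrite subr_gt0.
  apply: filterS (nbhsx_ballx y _ d0) => z; rewrite !ballEmdist /= => yz.
  by have := metric_triangle (x i) y z; lra.
- move=> y _; have : [set: X] y by [].
  rewrite -cover => -[i _ /= iy]; exists i => //.
  by rewrite ballEmdist /=; exact: le_lt_trans iy (rr' i).
apply: (@urysohn_width_le_balls _ _ F (fun i => x (val i)) (fun i => r' (val i))) => //.
- by move=> i; apply: le_trans (r0 _) (ltW (rr' _)).
- move=> y; have [i iF] := FX y Logic.I; rewrite ballEmdist /= => iy.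
  by exists [` iF]%fset.
- rewrite -(big_seq_fsetE _ F xpredT (fun i => r' i ^+ m)) /=.
  apply: le_lt_trans (sumr' F) _.
  have : \sum_(i <- F) r i ^+ m <= sigma.
    rewrite -lee_fin -sE; apply: esum_ge; exists [set` F]; first by split.
    by rewrite fsbig_finite //= set_fsetK sumEFin.
  by lra.
Qed.

Theorem theorem1p5 (R : realType) (m : nat) (m_gt0 : (0 < m)%N) :
  exists c : R, forall X : metricType R, compact [set: X] ->
    (urysohn_width m.-1 X <= c%:E * hausdorff_content m X `^ (m%:R^-1))%E.
Proof.
exists (6 * m + 2)%:R => X cX.
have c0 : 0 < (6 * m + 2)%:R :> R by rewrite ltr0n addn2.
have hc0 : (0 <= hausdorff_content m X)%E.
  apply: le_ereal_inf_tmp => _ [I [x [r [r0 _ ->]]]].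
  by apply: esum_ge0 => i _; rewrite lee_fin exprn_ge0.
have bound := @urysohn_width_le_of_content_lt R X m _ m_gt0 cX.
case: (hausdorff_content m X) hc0 bound => [h| |] //; last first.
  by move=> _ _; rewrite poweRyr ?gt_eqF ?invr_gt0 ?ltr0n // gt0_muley ?lte_fin // leey.
rewrite lee_fin => h0 bound.
rewrite poweR_EFin -EFinM.
apply/lee_addgt0Pr => e e0.
set b := h `^ m%:R^-1.
have b0 : 0 <= b by exact: powR_ge0.
have bE : b ^+ m = h.
  by rewrite -powR_mulrn // -powRrM mulVf ?powRr1 // pnatr_eq0 -lt0n.
have d0 : 0 < e / (6 * m + 2)%:R by rewrite divr_gt0.
have -> : (((6 * m + 2)%:R * b)%:E + e%:E)%E
    = ((6 * m + 2)%:R * (b + e / (6 * m + 2)%:R))%:E.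
  by rewrite -EFinD mulrDr mulrCA divff ?mulr1 // gt_eqF.
apply: bound; first by rewrite ltr_wpDl.
by rewrite lte_fin -{1}bE ltr_pXn2r ?nnegrE ?addr_ge0 ?ltrDl // ltW.
Qed.
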